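(* Let $\mathbb{V}$ be a real topological vector space, $\mathbb{K}\subset\mathbb{V}$ a (closed, convex) topologically normal cone with non-empty interior, with induced partial order $\preceq$, and let $\mathbf{e}\in\mathrm{int}(\mathbb{K})$ with associated gauge norm $\|\cdot\|_{\mathbf{e}}$. Let $\theta^*\in\mathbb{V}$, and let $\{\mathcal{H}_k\}_{k\ge 1}$ be a sequence of operators $\mathcal{H}_k:\mathbb{V}\to\mathbb{V}$ such that for every $k\geq 1$: (i) (monotonicity) $\mathcal{H}_k(\theta)\preceq\mathcal{H}_k(\theta')$ whenever $\theta\preceq\theta'$; (ii) (quasi-contractivity) there is $\nu_k\in(0,1)$ such that $\|\mathcal{H}_k(\theta)-\mathcal{H}_k(\theta^* )\|_{\mathbf{e}}\le \nu_k\|\theta-\theta^*\|_{\mathbf{e}}$ for all $\theta\in\mathbb{V}$. Let $\{E_k\}_{k\ge1}$ be an arbitrary sequence in $\mathbb{V}$, let $\{\lambda_k\}_{k\ge1}$ be any sequence of stepsizes in $(0,1)$, let $\theta_1\in\mathbb{V}$ be arbitrary, and let $$\theta_{k+1}=(1-\lambda_k)\theta_k+\lambda_k\{\mathcal{H}_k(\theta_k)+E_k\},\qquad k\ge1.$$ Define $W_k=\mathcal{H}_k(\theta^* )-\theta^*+E_k$ for $k\ge 1$, and define sequences $\{P_k\}$ in $\mathbb{V}$ and $\{b_k\},\{a_k\}$ of non-negative scalars by $P_1=0$, $b_1=\|\theta_1-\theta^*\|_{\mathbf{e}}$, $a_1=0$, and for $k\ge2$ $$P_k=(1-\lambda_{k-1})P_{k-1}+\lambda_{k-1}W_{k-1},$$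 $$b_k=\bigl(1-(1-\nu_{k-1})\lambda_{k-1}\bigr)b_{k-1},$$ $$a_k=\bigl(1-(1-\nu_{k-1})\lambda_{k-1}\bigr)a_{k-1}+\nu_{k-1}\lambda_{k-1}\|P_{k-1}\|_{\mathbf{e}}.$$ Then for all $k\ge1$, $$-b_k\mathbf{e}-a_k\mathbf{e}+P_k\;\preceq\;\theta_k-\theta^*\;\preceq\; b_k\mathbf{e}+a_k\mathbf{e}+P_k .$$
   Context: The cone $\mathbb{K}$ induces the partial order $\theta\preceq\theta'\iff\theta'-\theta\in\mathbb{K}$ on $\mathbb{V}$. For $\mathbf{e}\in\mathrm{int}(\mathbb{K})$, the order interval is $[-\mathbf{e},\mathbf{e}]=\{\theta\in\mathbb{V}\mid-\mathbf{e}\preceq\theta\preceq\mathbf{e}\}$ and the associated gauge (Minkowski) norm is $\|\theta\|_{\mathbf{e}}=\inf\{s>0\mid\theta/s\in[-\mathbf{e},\mathbf{e}]\}$. Topologically normal means that $\mathbb{V}$ has a base of neighbourhoods $U$ of $0$ that are full, i.e. $x\preceq z\preceq y$ with $x,y\in U$ implies $z\in U$. It is not required that $\theta^*$ be a fixed point of each $\mathcal{H}_k$. *)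

(* Defs.v *)
From HB Require Import structures.
From mathcomp Require Import all_boot all_order all_algebra.
From mathcomp Require Import boolp classical_sets reals topology convex tvs.

Set Implicit Arguments.
Unset Strict Implicit.
Unset Printing Implicit Defensive.

Import Order.TTheory GRing.Theory Num.Theory.

Local Open Scope classical_set_scope.
Local Open Scope ring_scope.

(* The last clause (pointedness) is antisymmetry of the induced order. *)
Definition closed_convex_cone (R : realType) (V : topologicalLmodType R)
    (K : set V) : Prop :=
  [/\ closed K,
      convex_set K,
      K 0,
      forall (t : R) (x : V), 0 <= t -> K x -> K (t *: x)
    & forall x : V, K x -> K (- x) -> x = 0].

Definition cone_le (R : realType) (V : topologicalLmodType R) (K : set V)
  (x y : V) : Prop := K (y - x).

Notation "x <=[ K ] y" := (cone_le K x y)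
  (at level 70, K at level 200, y at next level,
   format "x  <=[ K ]  y") : ring_scope.

Definition full (R : realType) (V : topologicalLmodType R) (K U : set V)
    : Prop :=
  forall x y z : V, U x -> U y -> x <=[K] z -> z <=[K] y -> U z.

(* The members of the base are neighbourhoods of 0, not necessarily open. *)
Definition topologically_normal (R : realType) (V : topologicalLmodType R)
    (K : set V) : Prop :=
  forall A : set V, nbhs (0 : V) A ->
    exists U : set V, [/\ nbhs (0 : V) U, full K U & U `<=` A].

Definition order_interval (R : realType) (V : topologicalLmodType R)
    (K : set V) (x y : V) : set V :=
  [set z | x <=[K] z /\ z <=[K] y].

(* [inf] is real-valued; when e is interior to K the set below is nonempty
   (and bounded below by 0), so the junk value of [inf] is never met. *)
Definition gauge_norm (R : realType) (V : topologicalLmodType R)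
    (K : set V) (e x : V) : R :=
  inf [set s : R | 0 < s /\ order_interval K (- e) e (s^-1 *: x)].

(* Main.v *)
(* With B(s) the order interval [-s e, s e], the invariant is
   theta_k - theta* - P_k \in B(b_k + a_k).  Subtracting P_k removes the noise:
   the next difference is (1 - lambda_k) times the current one plus
   lambda_k (H_k theta_k - H_k theta* ), and monotonicity with contractivity at
   the two endpoints of theta* + P_k + B(b_k + a_k) puts the last bracket in
   B(nu_k (b_k + a_k + |P_k|_e)). *)
Require Import Defs.
From HB Require Import structures.
From mathcomp Require Import all_boot all_order all_algebra.
From mathcomp Require Import boolp classical_sets reals topology convex tvs.
From mathcomp Require Import interval_inference normedtype ring lra.

Set Implicit Arguments.
Unset Strict Implicit.
Unset Printing Implicit Defensive.

Import Order.TTheory GRing.Theory Num.Theory.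
Import numFieldNormedType.Exports.

Local Open Scope classical_set_scope.
Local Open Scope ring_scope.

Section Gauge.
Variables (R : realType) (V : topologicalLmodType R) (K : set V) (e : V).
Hypotheses (coneK : closed_convex_cone K) (intKe : interior K e).

Lemma cone0 : K 0.
Proof. by case: coneK. Qed.

Lemma coneZ (t : R) x : 0 <= t -> K x -> K (t *: x).
Proof. by case: coneK => _ _ _ + _; apply. Qed.

(** The sum is twice the midpoint, which convexity puts in [K]. *)
Lemma coneD x y : K x -> K y -> K (x + y).
Proof.
case: coneK => _ cK _ _ _ Kx Ky.
have h0 : 0 <= 2^-1 :> R by rewrite invr_ge0.
have h1 : 2^-1 <= 1 :> R by rewrite invf_le1 ?ler1n.
have mid : K (2^-1 *: x + (1 - 2^-1) *: y).
  by have := cK x y (Itv01 h0 h1); rewrite !inE; apply.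
have -> : x + y = 2 *: (2^-1 *: x + (1 - 2^-1) *: y).
  have -> : 1 - 2^-1 = 2^-1 :> R by field.
  by rewrite -scalerDr scalerA divff ?scale1r// pnatr_eq0.
exact: coneZ.
Qed.

Lemma cone_le_trans x y z : x <=[K] y -> y <=[K] z -> x <=[K] z.
Proof. by move=> xy yz; have := coneD yz xy; rewrite /cone_le subrKA. Qed.

Lemma cone_e : K e.
Proof. exact: interior_subset intKe. Qed.

(** Scaling [e] by [s], rather than the vector by [s^-1] as in [gauge_norm], keeps radius 0
    meaningful. *)
Definition gauge_ball (s : R) : set V :=
  order_interval K (- (s *: e)) (s *: e).

Lemma gauge_ballE s x : gauge_ball s x <-> K (s *: e + x) /\ K (s *: e - x).
Proof. by rewrite /gauge_ball /order_interval /cone_le /= opprK addrC. Qed.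

Lemma gauge_ballD s t x y :
  gauge_ball s x -> gauge_ball t y -> gauge_ball (s + t) (x + y).
Proof.
move=> /gauge_ballE[x1 x2] /gauge_ballE[y1 y2]; apply/gauge_ballE.
by rewrite scalerDl opprD; split; rewrite addrACA; apply: coneD.
Qed.

Lemma gauge_ballZ r s x :
  0 <= r -> gauge_ball s x -> gauge_ball (r * s) (r *: x).
Proof.
move=> r0 /gauge_ballE[x1 x2]; apply/gauge_ballE.
by rewrite -scalerA -scalerDr -scalerBr; split; apply: coneZ.
Qed.

Lemma gauge_ball_le s t x : s <= t -> gauge_ball s x -> gauge_ball t x.
Proof.
move=> st sx; rewrite -(subrKC s t) -[x]addr0; apply: gauge_ballD => //.
by apply/gauge_ballE; rewrite subr0 addr0; split;
  apply: coneZ; rewrite ?subr_ge0//; exact: cone_e.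
Qed.

Lemma gauge_ball_between s x y z :
  gauge_ball s x -> gauge_ball s y -> x <=[K] z -> z <=[K] y -> gauge_ball s z.
Proof.
by move=> [sx _] [_ sy] xz zy; split;
  [exact: cone_le_trans xz|exact: cone_le_trans sy].
Qed.

Let gauge_set (x : V) : set R :=
  [set s : R | 0 < s /\ order_interval K (- e) e (s^-1 *: x)].

Lemma gauge_setE x s : gauge_set x s <-> 0 < s /\ gauge_ball s x.
Proof.
have ball1 y : order_interval K (- e) e y <-> gauge_ball 1 y.
  by rewrite /gauge_ball scale1r.
split=> -[s0]; [move=> /ball1|].
  move=> /(gauge_ballZ (ltW s0)); rewrite mulr1 scalerA divff ?gt_eqF//.
  by rewrite scale1r.
have sV0 : 0 <= s^-1 by rewrite invr_ge0 ltW.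
by move=> /(gauge_ballZ sV0); rewrite mulVf ?gt_eqF// => /ball1.
Qed.

(** Since [e + t *: x] tends to the interior point [e] as [t] tends to 0, it lies in [K] for some
    [t > 0]; scaling by [t^-1] gives the claim with [s = t^-1]. *)
Lemma cone_absorbing x : exists2 s : R, 0 < s & K (s *: e + x).
Proof.
have cx : ((fun t : R^o => e + t *: x) @ 0 --> e).
  have h : (fun t : R^o => e + t *: x) @ 0 --> e + (0 : R^o) *: x.
    have := @add_continuous V (e, (0 : R^o) *: x).
    move=> /(cvg_comp2 (@cvg_cst _ e _ (nbhs (0 : R^o)) _)); apply.
    have := @scale_continuous R V ((0 : R^o), x).
    by move=> /(cvg_comp2 cvg_id (@cvg_cst _ x _ (nbhs (0 : R^o)) _)).
  by rewrite scale0r addr0 in h.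
have /nbhs_ballP[d /= d0 dK] := cx _ intKe.
have d2 : 0 < d / 2 by rewrite divr_gt0.
exists (d / 2)^-1; first by rewrite invr_gt0.
have : K (e + (d / 2) *: x).
  apply: dK; rewrite -ball_normE /= sub0r normrN gtr0_norm//; lra.
have dV0 : 0 <= (d / 2)^-1 by rewrite invr_ge0 ltW.
by move=> /(coneZ dV0); rewrite scalerDr scalerA mulVf ?scale1r// gt_eqF.
Qed.

Lemma gauge_set_has_inf x : has_inf (gauge_set x).
Proof.
split; last by exists 0 => s [/ltW].
have [s s0 xs] := cone_absorbing x; have [t t0 xt] := cone_absorbing (- x).
(* [s] serves [x] and [t] serves [- x]; the sum serves both, because the surplus multiple of [e]
   stays in [K]. *)
exists (s + t); apply/gauge_setE; split; first exact: addr_gt0.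
apply/gauge_ballE; rewrite scalerDl; split.
  by rewrite addrAC; apply: coneD => //; apply: coneZ (ltW t0) cone_e.
by rewrite -addrA; apply: coneD => //; apply: coneZ (ltW s0) cone_e.
Qed.

Lemma gauge_norm_ge0 x : 0 <= gauge_norm K e x.
Proof.
by apply: lb_le_inf; [case: (gauge_set_has_inf x)|move=> s [/ltW]].
Qed.

(** Closedness of [K] along the half-line of direction [e]; this is what makes the infimum in the
    gauge norm attained. *)
Lemma cone_right_limit (s : R) y :
  (forall r, s < r -> K (r *: e + y)) -> K (s *: e + y).
Proof.
case: coneK => cK _ _ _ _ Ky; apply: cK => U.
have cy : ((fun t : R^o => t *: e + y) @ (s : R^o) --> s *: e + y).
  have := @add_continuous V (s *: e, y).
  move=> /(cvg_comp2 _ (@cvg_cst _ y _ (nbhs (s : R^o)) _)); apply.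
  have := @scale_continuous R V ((s : R^o), e).
  by move=> /(cvg_comp2 cvg_id (@cvg_cst _ e _ (nbhs (s : R^o)) _)).
move=> /cy /nbhs_ballP[d /= d0 dU].
exists ((s + d / 2) *: e + y); split.
  by apply: Ky; rewrite ltrDl divr_gt0.
by apply: dU; rewrite -ball_normE /= opprD addNKr normrN gtr0_norm; lra.
Qed.

Lemma gauge_ball_norm x : gauge_ball (gauge_norm K e x) x.
Proof.
(* Every radius strictly above the infimum exceeds a member of [gauge_set x], and balls grow with
   the radius. *)
have above r : gauge_norm K e x < r -> gauge_ball r x.
  have [neS _] := gauge_set_has_inf x.
  move=> /(inf_lt neS)[t /gauge_setE[_ xt] tr].
  exact: gauge_ball_le (ltW tr) xt.
by apply/gauge_ballE; split; apply: cone_right_limit => r /above /gauge_ballE[].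
Qed.

Lemma gauge_norm_le s x : 0 <= s -> gauge_ball s x -> gauge_norm K e x <= s.
Proof.
move=> s0 sx; apply/ler_addgt0Pr => r r0; apply: ge_inf.
  by have [] := gauge_set_has_inf x.
apply/gauge_setE; split; first exact: ltr_wpDl.
by apply: gauge_ball_le sx; rewrite lerDl ltW.
Qed.

Lemma monotone_contraction_ball (F : V -> V) (x0 : V) (n c : R) :
  (forall x y, x <=[K] y -> F x <=[K] F y) ->
  0 <= n ->
  (forall x, gauge_norm K e (F x - F x0) <= n * gauge_norm K e (x - x0)) ->
  0 <= c -> forall x p, gauge_ball c (x - x0 - p) ->
  gauge_ball (n * (c + gauge_norm K e p)) (F x - F x0).
Proof.
move=> F_mono n0 F_contr c0 x p xp.
(* By the triangle inequality [q + p] has norm at most [c] plus the norm of [p], whence the radius.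
   The relevant [q] are the two extremes of the order interval, [c *: e] and its opposite. *)
have endpoint q : gauge_ball c q ->
    gauge_ball (n * (c + gauge_norm K e p)) (F (x0 + (q + p)) - F x0).
  move=> cq; apply: gauge_ball_le (gauge_ball_norm _).
  apply: le_trans (F_contr _) _; apply: ler_wpM2l => //.
  rewrite addrC addKr; apply: gauge_norm_le.
    by rewrite addr_ge0// gauge_norm_ge0.
  exact: gauge_ballD cq (gauge_ball_norm _).
have ce0 : K ((c + c) *: e) by apply: coneZ cone_e; rewrite addr_ge0.
have ballc : gauge_ball c (c *: e).
  by apply/gauge_ballE; rewrite subrr -scalerDl; split => //; exact: cone0.
have ballNc : gauge_ball c (- (c *: e)).
  by apply/gauge_ballE; rewrite subrr opprK -scalerDl; split => //; exact: cone0.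
(* In this form [x] lies between the two translated extremes, so monotonicity encloses its image. *)
have -> : x = x0 + (x - x0 - p + p) by rewrite subrK subrKC.
have translate q r : q <=[K] r -> x0 + (q + p) <=[K] x0 + (r + p).
  by rewrite /cone_le opprD addrACA subrr add0r opprD addrACA subrr addr0.
case: xp => lo hi.
by apply: gauge_ball_between (endpoint _ ballNc) (endpoint _ ballc) _ _;
  rewrite /cone_le opprB addrA subrK; exact/F_mono/translate.
Qed.

End Gauge.

Theorem theorem1 (R : realType) (V : topologicalLmodType R)
  (K : set V) (e : V)
  (coneK : closed_convex_cone K)
  (normalK : topologically_normal K)
  (intKe : interior K e)
  (thetastar : V)
  (H : nat -> V -> V)
  (nu : nat -> R)
  (H_mono : forall k, (1 <= k)%N ->
     forall x y : V, x <=[K] y -> H k x <=[K] H k y)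
  (nu01 : forall k, (1 <= k)%N -> 0 < nu k < 1)
  (H_contr : forall k, (1 <= k)%N -> forall x : V,
     gauge_norm K e (H k x - H k thetastar)
       <= nu k * gauge_norm K e (x - thetastar))
  (E : nat -> V)
  (lambda : nat -> R)
  (lambda01 : forall k, (1 <= k)%N -> 0 < lambda k < 1)
  (theta : nat -> V)
  (thetaS : forall k, (1 <= k)%N ->
     theta k.+1
       = (1 - lambda k) *: theta k + lambda k *: (H k (theta k) + E k))
  (W : nat -> V)
  (WE : forall k, (1 <= k)%N -> W k = H k thetastar - thetastar + E k)
  (P : nat -> V) (b a : nat -> R)
  (P1 : P 1%N = 0)
  (b1 : b 1%N = gauge_norm K e (theta 1%N - thetastar))
  (a1 : a 1%N = 0)
  (PE : forall k, (2 <= k)%N ->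
     P k = (1 - lambda k.-1) *: P k.-1 + lambda k.-1 *: W k.-1)
  (bE : forall k, (2 <= k)%N ->
     b k = (1 - (1 - nu k.-1) * lambda k.-1) * b k.-1)
  (aE : forall k, (2 <= k)%N ->
     a k = (1 - (1 - nu k.-1) * lambda k.-1) * a k.-1
           + nu k.-1 * lambda k.-1 * gauge_norm K e (P k.-1)) :
  forall k, (1 <= k)%N ->
    - (b k *: e) - a k *: e + P k <=[K] theta k - thetastar
    /\ theta k - thetastar <=[K] b k *: e + a k *: e + P k.
Proof.
have e0 := gauge_norm_ge0 coneK intKe.
have rate01 k : (1 <= k)%N -> 0 <= 1 - (1 - nu k) * lambda k.
  by move=> k1; have := nu01 _ k1; have := lambda01 _ k1; nra.
(* Both sides of the claim form one ball membership. The signs join the induction because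
   [monotone_contraction_ball] needs a non-negative radius. *)
suff main k : (1 <= k)%N -> [/\ 0 <= b k, 0 <= a k &
    gauge_ball K e (b k + a k) (theta k - thetastar - P k)].
  move=> k /main[_ _ /gauge_ballE].
  rewrite /cone_le -scalerDl -opprD -scalerDl => -[lo hi].
  by split; [rewrite opprD opprK addrCA|rewrite -addrA -opprB].
(* Index 0 is vacuous; the base case is index 1. *)
elim: k => // -[_ _|k IH _].
  rewrite b1 a1 P1 subr0 addr0; split=> //; exact: gauge_ball_norm.
have {IH}[//|b0 a0 ball] := IH; set n := k.+1 in b0 a0 ball *.
have n1 : (1 <= n)%N by []; have n2 : (2 <= n.+1)%N by [].
have /andP[nu0 nu1] := nu01 n n1; have /andP[l0 l1] := lambda01 n n1.
rewrite bE// aE//= -/n; split.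
- by rewrite mulr_ge0// rate01.
- by rewrite addr_ge0 ?mulr_ge0 ?rate01// ltW.
(* Split [thetastar] with weights [1 - lambda n] and [lambda n]: in the second part [E n] and
   [thetastar] cancel against [W n], leaving [- H n thetastar]. *)
have -> : theta n.+1 - thetastar - P n.+1 =
    (1 - lambda n) *: (theta n - thetastar - P n)
    + lambda n *: (H n (theta n) - H n thetastar).
  rewrite thetaS// PE//= WE// -{1}[thetastar]scale1r -{2}(subrK (lambda n) 1).
  rewrite (scalerDl thetastar) !opprD [X in X + _ = _]addrACA [LHS]addrACA.
  rewrite -!scalerBr; congr (_ + _ *: _).
  by rewrite (addrAC (H n thetastar)) -(addrA (H n (theta n)))
    -(addrA (H n thetastar)) opprD addrACA
    subrr addr0.
(* The factor [1 - (1 - nu n) * lambda n] is [(1 - lambda n) + lambda n * nu n], so the new radius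
   is the same convex combination as the vector. *)
have -> : (1 - (1 - nu n) * lambda n) * b n +
    ((1 - (1 - nu n) * lambda n) * a n
     + nu n * lambda n * gauge_norm K e (P n)) =
    (1 - lambda n) * (b n + a n)
    + lambda n * (nu n * (b n + a n + gauge_norm K e (P n))) by ring.
apply: gauge_ballD => //; apply: gauge_ballZ => //.
- by rewrite subr_ge0 ltW.
- exact: ltW.
- apply: monotone_contraction_ball => //.
  + exact: H_mono.
  + exact: ltW.
  + exact: H_contr.
  + exact: addr_ge0.
Qed.
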